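(* Let $X$ be a real Hilbert space, $A,B\colon X\rightrightarrows X$ maximally monotone, $T:=\operatorname{Id}-J_A+J_BR_A$, $v:=P_{\overline{\operatorname{ran}}(\operatorname{Id}-T)}(0)$, $D:=\operatorname{dom}A-\operatorname{dom}B$, $R:=\operatorname{ran}A+\operatorname{ran}B$, $v_D:=P_{\overline D}(0)$, $v_R:=P_{\overline R}(0)$, and assume $\overline{\operatorname{ran}}(\operatorname{Id}-T)=\overline{D\cap R}=\overline D\cap\overline R$. Suppose that $f\in\operatorname{Fix}(v+T)$ and let $x\in X$. Then: (i) the sequence $(J_AT^nx+nv_R,\,J_{A^{-1}}T^nx+nv_D)_{n\in\mathbb N}$ is Fejér monotone with respect to $\{(J_Ay,J_{A^{-1}}y): y\in\operatorname{Fix}(v+T)\}$; (ii) the sequence $(J_AT^nx+nv_R,\,J_{A^{-1}}T^nx+nv_D)_{n}$ is bounded; (iii) the sequence $(J_BR_AT^nx+nv_R,\,J_{B^{-1}}R_AT^nx-nv_D)_n$ is bounded; (iv) the sequence $\big((0,-v)+(J_AT^nx+nv_R,\,J_{A^{-1}}T^nx+nv_D)\big)_n$ is Fejér monotone with respect to $\mathcal S$; (v) $(J_AT^nx)_n$ is bounded if and only if $v_R=0$; (vi) if $v_R\neq0$, then $\|J_AT^nx\|\to+\infty$; (vii) $(J_{A^{-1}}T^nx)_n$ is bounded if and only if $v_D=0$; (viii) if $v_D\neq0$, then $\|J_{A^{-1}}T^nx\|\to+\infty$; (ix) if $A$ and $B$ are paramonotone, then the sequence $\big((0,-v)+(J_AT^nx+nv_R,\,J_{A^{-1}}T^nx+nv_D)\big)_n$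 is Fejér monotone with respect to $Z\times K$.
   Context: $J_C:=(\operatorname{Id}+C)^{-1}$, $R_C:=2J_C-\operatorname{Id}$ for maximally monotone $C$. $P_S$ is the projection onto a nonempty closed convex set. $\operatorname{Fix}(v+T):=\{y\in X: y=v+Ty\}$. A sequence $(x_n)$ in a Hilbert space (here $X\times X$ with the product norm) is Fejér monotone with respect to a nonempty set $C$ if $\|x_{n+1}-c\|\le\|x_n-c\|$ for all $c\in C$ and $n$. $\mathcal S:=\{(z,k)\in X\times X: -k\in B(z-v),\ k\in -v+Az\}$. $Z:=\{x\in X: 0\in -v+Ax+B(x-v)\}$ and $K:=\{k\in X: 0\in(-v+A)^{-1}(k)+(B(\cdot-v))^{-\vee}(k)\}$, where for an operator $M$, $M^{-\vee}:=(-\operatorname{Id})\circ M^{-1}\circ(-\operatorname{Id})$; equivalently $K=\{k: A^{-1}(k+v)\cap(v+B^{-1}(-k))\neq\varnothing\}$. A monotone $C$ is paramonotone if whenever $(x,u),(y,w)\in\operatorname{gra}C$ and $\langle x-y,u-w\rangle=0$, then $(x,w),(y,u)\in\operatorname{gra}C$. *)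

(* Defs.v *)
From HB Require Import structures.
From mathcomp Require Import all_boot all_order all_algebra.
From mathcomp Require Import all_classical all_reals all_analysis.
Set Implicit Arguments. Unset Strict Implicit. Unset Printing Implicit Defensive.
Import Order.TTheory GRing.Theory Num.Theory.
Import numFieldNormedType.Exports.
Local Open Scope classical_set_scope.
Local Open Scope ring_scope.

Section Defs.
Variables (R : realType) (X : completeNormedModType R).

(* ip is a real inner product inducing the norm of X: together with the
   completeness of X this makes X a real Hilbert space. *)
Definition hinner_product (ip : X -> X -> R) : Prop :=
  (forall x y, ip x y = ip y x) /\
  (forall (a : R) x y z, ip (a *: x + y) z = a * ip x z + ip y z) /\
  (forall x, ip x x = `|x| ^+ 2).

Definition hmonotone (ip : X -> X -> R) (C : X -> set X) : Prop :=
  forall x y u w, C x u -> C y w -> 0 <= ip (x - y) (u - w).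

Definition hmaximally_monotone ip (C : X -> set X) : Prop :=
  hmonotone ip C /\
  forall C' : X -> set X, hmonotone ip C' -> (forall x u, C x u -> C' x u) ->
    forall x u, C' x u -> C x u.

Definition hparamonotone ip (C : X -> set X) : Prop :=
  hmonotone ip C /\
  forall x y u w, C x u -> C y w -> ip (x - y) (u - w) = 0 -> C x w /\ C y u.

Definition hop_inv (C : X -> set X) : X -> set X := fun u x => C x u.
Definition hdom (C : X -> set X) : set X := [set x | exists u, C x u].
Definition hran (C : X -> set X) : set X := [set u | exists x, C x u].

(* hresolvent J_C = (Id + C)^{-1}: J_C x is the p with x - p ∈ C p *)
Definition hresolvent (C : X -> set X) (x : X) : X :=
  xget 0 [set p | C p (x - p)].
Definition hreflected (C : X -> set X) (x : X) : X :=
  2%:R *: hresolvent C x - x.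

Definition hproj (S : set X) (y : X) : X :=
  xget 0 [set p | S p /\ forall q, S q -> `|y - p| <= `|y - q|].

Definition hfixset (g : X -> X) : set X := [set y | y = g y].

Definition hpnorm (p : X * X) : R := Num.sqrt (`|p.1| ^+ 2 + `|p.2| ^+ 2).

Definition hfejer (s : nat -> X * X) (C : set (X * X)) : Prop :=
  forall c n, C c -> hpnorm (s n.+1 - c) <= hpnorm (s n - c).

Definition hpbounded (s : nat -> X * X) : Prop :=
  exists M : R, forall n, hpnorm (s n) <= M.

Definition hbounded_seq (s : nat -> X) : Prop :=
  exists M : R, forall n, `|s n| <= M.

Definition hset_diff (S1 S2 : set X) : set X :=
  [set z | exists a b, S1 a /\ S2 b /\ z = a - b].
Definition hset_sum (S1 S2 : set X) : set X :=
  [set z | exists a b, S1 a /\ S2 b /\ z = a + b].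
End Defs.

(* Main.v *)
(** Minty's theorem makes the resolvents total.  Since [vD] bounds [dom A] and
    [dom B] in opposite half-spaces, [- vD] and [vD] are recession directions of the
    closures of [ran A] and [ran B]; dually for [vR].  Hence [vD] and [vR] are
    orthogonal, [vD + vR] lies in both closures, and [v = vD + vR].

    For a fixed point [y] of [v + T], the Douglas-Rachford identity and the minimality
    of [|v|] give [T y = y - v] and the orthogonality of the shadow increments
    [p = J_A y - J_A (T y)] and [q = J_{A^-1} y - J_{A^-1} (T y)], with [p + q = v].
    Comparing [J_A y] and [J_B R_A (T y)], and conversely, with the half-space of [vD]
    gives [<vD, p> = 0], and likewise [<vR, q> = 0]; so [p = vR] and [q = vD].
    Thus adding [n vR] and [n vD] to the shadows of [T^n x] amounts to comparing them
    with the shadows of [T^n y], and one step of [T] does not increase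
    [|J_A x - J_A y|^2 + |J_{A^-1} x - J_{A^-1} y|^2]. *)

Require Import Defs.
From HB Require Import structures.
From mathcomp Require Import all_boot all_order all_algebra.
From mathcomp Require Import all_classical all_reals all_analysis.
From mathcomp Require Import ring lra.
Import Order.TTheory GRing.Theory Num.Theory.
Import numFieldNormedType.Exports.
Local Open Scope classical_set_scope.
Local Open Scope ring_scope.

(** * First-order inequalities and closures *)

Lemma ge0_of_quadratic {R : realType} (a b : R) :
  (forall t, 0 < t <= 1 -> 0 <= t * a + t ^+ 2 * b) -> 0 <= a.
Proof.
move=> H; rewrite leNgt; apply/negP => a0.
have b0 : 0 < `|b| + 1 - a by have := normr_ge0 b; lra.
(* This admissible [t] solves [t * (|b| + 1 - a) = - a], which forces
   [a + t * b <= - t * (1 - a) < 0]. *)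
pose t := - a / (`|b| + 1 - a).
have t0 : 0 < t by rewrite divr_gt0// oppr_gt0.
have t1 : t <= 1 by rewrite ler_pdivrMr// mul1r; have := normr_ge0 b; lra.
have {H} : 0 <= t * (a + t * b) by have := H t; rewrite t0 t1 mulrDr mulrA -expr2; exact.
rewrite pmulr_rge0//; apply/negP; rewrite -ltNge.
have : t * b <= t * `|b| by rewrite ler_pM2l// ler_norm.
have : t * (`|b| + 1 - a) = - a by rewrite /t divfK// gt_eqF.
have : 0 < t * (1 - a) by rewrite mulr_gt0//; lra.
rewrite !mulrDr; lra.
Qed.

Lemma closure_normP {R : realType} {V : normedModType R} (S : set V) (x : V) :
  closure S x <-> forall e, 0 < e -> exists2 y, S y & `|x - y| < e.
Proof.
split=> [Sx e e0|H B].
  have [y [Sy xy]] := Sx _ (nbhsx_ballx x e e0).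
  by exists y => //; move: xy; rewrite -ball_normE.
rewrite -nbhs_ballE => -[e /= e0 eB]; have [y Sy xy] := H e e0.
by exists y; split=> //; apply: eB; rewrite -ball_normE.
Qed.

(** Translation preserves distances, so an approximant of [s] in [S] can be moved by [u] first and
    approximated in [S] again. *)
Lemma closure_add {R : realType} {V : normedModType R} (S : set V) (u : V) :
  (forall s, S s -> closure S (s + u)) ->
  forall s, closure S s -> closure S (s + u).
Proof.
move=> H s /closure_normP Ss; apply/closure_normP => e e0.
have e2 : 0 < e / 2 by lra.
have [y Sy sy] := Ss _ e2; have /closure_normP/(_ _ e2)[z Sz yz] := H _ Sy.
exists z => //; rewrite (_ : s + u - z = (s - y) + (y + u - z)).
  by apply: le_lt_trans (ler_normD _ _) _; lra.
by rewrite !addrA subrK.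
Qed.

(** * Inner-product calculus, minimizing sequences and projections *)

Section Hilbert.
Variables (R : realType) (X : completeNormedModType R) (ip : X -> X -> R).
Hypothesis ip_inner : hinner_product ip.

Local Notation "<| x , y |>" := (ip x y) (at level 0, format "<| x ,  y |>").

Lemma ipC x y : <|x, y|> = <|y, x|>. Proof. by case: ip_inner. Qed.
Lemma ipE x : <|x, x|> = `|x| ^+ 2. Proof. by case: ip_inner => _ []. Qed.
Lemma ipDl x y z : <|x + y, z|> = <|x, z|> + <|y, z|>.
Proof. by case: ip_inner => _ [+ _] => /(_ 1 x y z); rewrite scale1r mul1r. Qed.
Lemma ip0l z : <|0, z|> = 0.
Proof. by have := ipDl 0 0 z; rewrite addr0; lra. Qed.
Lemma ipZl a x z : <|a *: x, z|> = a * <|x, z|>.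
Proof. by case: ip_inner => _ [+ _] => /(_ a x 0 z); rewrite addr0 ip0l addr0. Qed.
Lemma ipNl x z : <|- x, z|> = - <|x, z|>.
Proof. by rewrite -scaleN1r ipZl mulN1r. Qed.
Lemma ipDr x y z : <|x, y + z|> = <|x, y|> + <|x, z|>.
Proof. by rewrite ipC ipDl !(ipC x). Qed.
Lemma ipZr a x z : <|x, a *: z|> = a * <|x, z|>.
Proof. by rewrite ipC ipZl (ipC x). Qed.
Lemma ipNr x z : <|x, - z|> = - <|x, z|>.
Proof. by rewrite ipC ipNl (ipC x). Qed.
Definition ip_linear := (ipDl, ipDr, ipNl, ipNr, ipZl, ipZr).

Lemma norm_le_sqr (x y : X) : (`|x| <= `|y|) = (`|x| ^+ 2 <= `|y| ^+ 2).
Proof. by rewrite ler_sqr ?nnegrE. Qed.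

Lemma norm_lt_eps (x : X) (e : R) : 0 < e -> (`|x| < e) = (`|x| ^+ 2 < e ^+ 2).
Proof. by move=> e0; rewrite ltr_sqr ?nnegrE// ltW. Qed.

Lemma norm_sqr_le0 (x : X) : `|x| ^+ 2 <= 0 -> x = 0.
Proof.
move=> x0; apply/eqP; rewrite -normr_eq0 -sqrf_eq0 eq_le x0 /=; exact: sqr_ge0.
Qed.

(** Strong convexity of the squared distance in exact form; [t = 1/2] is the parallelogram law. *)
Lemma norm_convex_comb (t : R) (z a b : X) :
  `|z - ((1 - t) *: a + t *: b)| ^+ 2 =
  (1 - t) * `|z - a| ^+ 2 + t * `|z - b| ^+ 2 - t * (1 - t) * `|a - b| ^+ 2.
Proof.
rewrite -!ipE !ip_linear (ipC a z) (ipC b z) (ipC b a); ring.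
Qed.

Lemma minimizing_sequence (I : Type) (E : set I) (g : I -> R) (l : R) :
  (exists i, E i) -> (forall i, E i -> l <= g i) ->
  exists m (i_ : nat -> I), (forall i, E i -> m <= g i) /\
    (forall n, E (i_ n) /\ g (i_ n) <= m + n.+1%:R^-1).
Proof.
move=> [i0 Ei0] lg; pose G := [set r | exists2 i, E i & r = g i].
have G0 : G !=set0 by exists (g i0), i0.
have lbG : has_lbound G by exists l => _ [i Ei ->]; exact: lg.
have H n : exists i, E i /\ g i <= inf G + n.+1%:R^-1.
  have n0 : 0 < n.+1%:R^-1 :> R by rewrite invr_gt0.
  by have [_ [i Ei ->] /ltW ?] := inf_adherent n0 (conj G0 lbG); exists i.
have [i_ Hi] := choice H; exists (inf G), i_; split=> // i Ei.
by apply: ge_inf => //; exists i.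
Qed.

(* The usual parallelogram-law argument, with the strong convexity of [g]
   transported by [e]. *)
Lemma minimizing_cvg (I : Type) (E : set I) (g : I -> R) (e : I -> X) m i_ :
  (forall i, E i -> m <= g i) ->
  (forall n, E (i_ n) /\ g (i_ n) <= m + n.+1%:R^-1) ->
  (forall i j, E i -> E j -> exists2 k, E k &
     g k <= (g i + g j) / 2 - `|e i - e j| ^+ 2 / 4) ->
  cvgn (e \o i_).
Proof.
move=> mg Hi mid; apply/cauchy_cvgP; apply: cauchy_exP => r r0.
have r2 : 0 < r ^+ 2 / 4 by rewrite divr_gt0// exprn_gt0.
near \oo => N.
exists (e (i_ N)); change (\forall n \near \oo, ball (e (i_ N)) r (e (i_ n))).
near=> n.
rewrite -ball_normE /= norm_lt_eps//.
have [EN gN] := Hi N; have [En gn] := Hi n.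
have [k Ek gk] := mid _ _ EN En; have mk := mg _ Ek.
have Nr : N.+1%:R^-1 < r ^+ 2 / 4.
  by near: N; exact: (near_infty_natSinv_lt (PosNum r2)).
have : n.+1%:R^-1 <= N.+1%:R^-1 :> R.
  by rewrite lef_pV2 ?posrE// ler_nat ltnS; near: n; exact: nbhs_infty_ge.
move: (N.+1%:R^-1) (n.+1%:R^-1) gN gn Nr => dN dn gN gn Nr dnN.
rewrite -(@ltr_pM2r _ 4^-1) ?invr_gt0//.
lra.
Unshelve. all: by end_near. Qed.

Lemma hproj_exists (S : set X) (y : X) : S !=set0 -> closed S ->
  (forall a b t, S a -> S b -> 0 <= t <= 1 -> S ((1 - t) *: a + t *: b)) ->
  exists p, S p /\ forall q, S q -> `|y - p| <= `|y - q|.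
Proof.
move=> S0 Scl Scv; pose g (x : X) := `|y - x| ^+ 2.
have [m [u [mg Hu]]] : exists m (u : nat -> X), (forall i, S i -> m <= g i) /\
    (forall n, S (u n) /\ g (u n) <= m + n.+1%:R^-1).
  by apply: (@minimizing_sequence _ S g 0) => // i _; exact: sqr_ge0.
have /cvg_ex[p up] : cvgn u.
  apply: (@minimizing_cvg _ S g id m) => // a b Sa Sb.
  exists ((1 - 2^-1) *: a + 2^-1 *: b); first by apply: Scv => //; lra.
  rewrite /g norm_convex_comb /=; lra.
exists p; split.
  by apply: (closed_cvg S Scl _ _ up); apply: nearW => n; case: (Hu n).
move=> q /mg mq; rewrite norm_le_sqr; apply: le_trans mq.
have gp : g (u n) @[n --> \oo] --> g p.
  by rewrite /g; under eq_fun do rewrite expr2; rewrite expr2;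
    apply: cvgM; apply: cvg_norm; apply: cvgB => //; exact: cvg_cst.
rewrite -[leRHS]addr0; apply: (ler_cvg_to gp (cvgD (cvg_cst m) (@cvg_harmonic R))).
by apply: nearW => n; case: (Hu n).
Qed.

Lemma hproj_spec (S : set X) (y : X) : S !=set0 -> closed S ->
  (forall a b t, S a -> S b -> 0 <= t <= 1 -> S ((1 - t) *: a + t *: b)) ->
  S (hproj S y) /\ forall q, S q -> <|hproj S y - y, hproj S y|> <= <|hproj S y - y, q|>.
Proof.
move=> S0 Scl Scv; have [] := xgetPex 0 (hproj_exists _ y S0 Scl Scv).
rewrite -/(hproj S y); set p := hproj S y => Sp pmin; split=> // q Sq.
(* This is the derivative at [t = 0] of the squared distance to [y] along the segment from [p] to
   [q]. *)
suff : 0 <= 2 * <|p - y, q - p|> by rewrite !ip_linear; lra.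
apply: (@ge0_of_quadratic _ _ (`|q - p| ^+ 2)) => t /andP[t0 t1].
have /pmin : S ((1 - t) *: p + t *: q) by apply: Scv => //; rewrite ltW.
rewrite norm_le_sqr norm_convex_comb -!ipE !ip_linear.
rewrite (ipC q p) (ipC q y) (ipC p y); nra.
Qed.

(** * Minty's theorem *)

(** Maximality tested one pair at a time, a form that passes readily to inverses and to the rescaled
    operator in [minty]. *)
Definition saturated_monotone (A : X -> set X) := hmonotone ip A /\
  forall x u, (forall y w, A y w -> 0 <= <|x - y, u - w|>) -> A x u.

Lemma hmaximally_monotone_saturated A :
  hmaximally_monotone ip A -> saturated_monotone A.
Proof.
move=> [mA maxA]; split=> // x u Axu.
apply: (maxA (fun y w => A y w \/ (y = x /\ w = u))); [|by left|by right].
move=> y z w w' [Ayw|[-> ->]] [Azw|[-> ->]].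
- exact: mA.
- by have := Axu _ _ Ayw; rewrite -[y - x]opprB -[w - u]opprB ipNl ipNr opprK.
- exact: Axu.
- by rewrite subrr ip0l.
Qed.

Lemma saturated_inv A : saturated_monotone A -> saturated_monotone (hop_inv A).
Proof.
move=> [mA sA]; split=> [x y u w Axu Ayw|x u H]; first by rewrite ipC; exact: mA.
by apply: sA => y w Ayw; rewrite ipC; exact: H.
Qed.

Lemma saturated_nonempty A : saturated_monotone A -> exists y w, A y w.
Proof.
move=> [_ sA]; apply: contrapT => H; apply: (H); exists 0, 0.
by apply: sA => y w Ayw; case: H; exists y, w.
Qed.

(* Minimize over [(a, b)] the supremum over [(y, w)] in [gra A] of
   [|y - a|^2 + |w - b|^2 - |y + w|^2].  That supremum is at least [|a + b|^2],
   and first-order optimality in the direction of [(- w, - y)] shows that the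
   minimizer [(a, b)] lies in [gra A] and that [a + b = 0]. *)
Lemma minty_zero A : saturated_monotone A -> exists a, A a (- a).
Proof.
move=> satA; have [mA sA] := satA; have [y0 [w0 Ayw0]] := saturated_nonempty A satA.
(* The epigraph of the supremum, so that points where it is infinite need no separate treatment. *)
pose E := [set i : X * X * R | forall y w, A y w ->
  `|y - i.1.1| ^+ 2 + `|w - i.1.2| ^+ 2 - `|y + w| ^+ 2 <= i.2].
pose g (i : X * X * R) := i.2.
have gapE (a b y w : X) : `|y - a| ^+ 2 + `|w - b| ^+ 2 - `|y + w| ^+ 2 =
    `|a + b| ^+ 2 - 2 * <|y + b, w + a|>.
  rewrite -!ipE !ip_linear (ipC w y) (ipC a y) (ipC w b) (ipC b a); ring.
have Egraph y w : A y w -> E (- w, - y, `|y + w| ^+ 2).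
  move=> Ayw y' w' Ayw' /=; rewrite gapE -opprD normrN [w + y]addrC.
  have := mA _ _ _ _ Ayw' Ayw; lra.
have Elb i : E i -> `|i.1.1 + i.1.2| ^+ 2 <= g i.
  case: i => -[a b] r /= Ei; rewrite leNgt /g /=; apply/negP => ri.
  (* If [r < |a + b|^2], every [<y + b, w + a>] is positive, so this pair is in the graph; its own
     gap is exactly [|a + b|^2], a contradiction. *)
  have : A (- b) (- a).
    apply: sA => y w /Ei /=; rewrite gapE !ip_linear; lra.
  by move=> /Ei /=; rewrite gapE addNr ip0l; lra.
have [m [i_ [mg Hi]]] := @minimizing_sequence _ E g 0
  (ex_intro _ _ (Egraph _ _ Ayw0)) (fun i Ei => le_trans (sqr_ge0 _) (Elb i Ei)).
have Econv i j (t : R) : E i -> E j -> 0 <= t <= 1 ->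
    E ((1 - t) *: i.1.1 + t *: j.1.1, (1 - t) *: i.1.2 + t *: j.1.2,
      (1 - t) * g i + t * g j -
      t * (1 - t) * (`|i.1.1 - j.1.1| ^+ 2 + `|i.1.2 - j.1.2| ^+ 2)).
  move=> Ei Ej t01 y w Ayw /=; rewrite !norm_convex_comb.
  have := Ei _ _ Ayw; have := Ej _ _ Ayw; rewrite /g; nra.
have mid i j : E i -> E j -> exists2 k, E k &
    g k <= (g i + g j) / 2 - (`|i.1.1 - j.1.1| ^+ 2 + `|i.1.2 - j.1.2| ^+ 2) / 4.
  move=> Ei Ej; have h : 0 <= (2^-1 : R) <= 1 by lra.
  by eexists; [exact: (Econv _ _ _ Ei Ej h)|rewrite /g /=; lra].
have /cvg_ex[a ua] : cvgn ((fun i : X * X * R => i.1.1) \o i_).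
  apply: (@minimizing_cvg _ E g _ m) => // i j Ei Ej.
  have [k Ek gk] := mid _ _ Ei Ej; exists k => //.
  by have := sqr_ge0 `|i.1.2 - j.1.2|; lra.
have /cvg_ex[b ub] : cvgn ((fun i : X * X * R => i.1.2) \o i_).
  apply: (@minimizing_cvg _ E g _ m) => // i j Ei Ej.
  have [k Ek gk] := mid _ _ Ei Ej; exists k => //.
  by have := sqr_ge0 `|i.1.1 - j.1.1|; lra.
have Em : E (a, b, m).
  move=> y w Ayw /=.
  have cy : (`|y - (i_ n).1.1| ^+ 2 + `|w - (i_ n).1.2| ^+ 2 - `|y + w| ^+ 2)
      @[n --> \oo] --> `|y - a| ^+ 2 + `|w - b| ^+ 2 - `|y + w| ^+ 2.
    apply: cvgB; last exact: cvg_cst.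
    by under eq_fun do rewrite !expr2; rewrite !expr2; apply: cvgD; apply: cvgM;
      apply: cvg_norm; apply: cvgB => //; exact: cvg_cst.
  rewrite -[leRHS]addr0; apply: (ler_cvg_to cy (cvgD (cvg_cst m) (@cvg_harmonic R))).
  by apply: nearW => n; have [/(_ _ _ Ayw) /le_trans] := Hi n; exact.
have ab y w : A y w -> `|a + b| ^+ 2 <= <|a - y, b - w|>.
  move=> Ayw; have := Elb _ Em; rewrite /g /= => abm.
  suff : 0 <= `|y + w| ^+ 2 - m - (`|a + w| ^+ 2 + `|b + y| ^+ 2).
    move: abm; rewrite -!ipE !ip_linear.
    rewrite (ipC w y) (ipC b a) (ipC w a) (ipC y b); lra.
  apply: (@ge0_of_quadratic _ _ (`|a + w| ^+ 2 + `|b + y| ^+ 2)) => t /andP[t0 t1].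
  have t01 : 0 <= t <= 1 by rewrite ltW.
  have /mg := Econv _ _ t Em (Egraph _ _ Ayw) t01; rewrite /g /= !opprK; lra.
(* By [ab], the pair [(a, b)] is monotonically related to the graph; once it belongs to the graph,
   [ab] at this very pair gives [a + b = 0]. *)
have Aab : A a b by apply: sA => y w /ab; apply: le_trans; exact: sqr_ge0.
exists a; rewrite (_ : - a = b)//; apply/eqP; rewrite eq_sym -addr_eq0 addrC.
by apply/eqP/norm_sqr_le0; rewrite (le_trans (ab _ _ Aab))// subrr ip0l.
Qed.

(** Apply [minty_zero] to [A / l - z], which inherits saturation because [l > 0]. *)
Lemma minty A (l : R) (z : X) : saturated_monotone A -> 0 < l ->
  exists x, A x (l *: (z - x)).
Proof.
move=> [mA sA] l0.
have [|x] := minty_zero (fun x u => A x (l *: (z + u))); last by exists x.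
split=> [x y u w Axu Ayw|x u H].
  have := mA _ _ _ _ Axu Ayw.
  by rewrite -scalerBr ipZr pmulr_rge0// opprD addrACA subrr add0r.
apply: sA => y w Ayw; have /H : A y (l *: (z + (l^-1 *: w - z))).
  by rewrite addrC subrK scalerA mulfV ?gt_eqF// scale1r.
rewrite opprB addrA -(pmulr_rge0 _ l0) -ipZr scalerBr scalerA mulfV ?gt_eqF//.
by rewrite scale1r [u + z]addrC.
Qed.

(** * Vector identities and orthogonality *)

Lemma ip_ext (x y : X) : (forall z, <|x, z|> = <|y, z|>) -> x = y.
Proof.
move=> xy; apply/eqP; rewrite -subr_eq0; apply/eqP/norm_sqr_le0.
by rewrite -ipE ipDl xy -ipDl subrr ip0l.
Qed.

Ltac vector_ring := apply: ip_ext => ?; rewrite ?ip_linear ?ip0l; ring.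

Lemma ip_young (x y : X) : 2 * <|x, y|> <= `|x| ^+ 2 + `|y| ^+ 2.
Proof.
have := sqr_ge0 `|x - y|; rewrite -!ipE !ip_linear (ipC y x); lra.
Qed.

(** Young's inequality gives [|p + q| <= |w|], while the last equation bounds [|p + q|^2] below by
    [|w|^2] plus nonnegative terms, so these all vanish. In use, [w] is the displacement one step
    after [p + q]. *)
Lemma displacement_rigid (p q w : X) (r : R) : 0 <= r -> 0 <= <|p, q|> ->
  `|p + q| ^+ 2 <= <|p + q, w|> ->
  `|p| ^+ 2 + `|q| ^+ 2 = `|w| ^+ 2 + `|p + q - w| ^+ 2 + r ->
  w = p + q /\ <|p, q|> = 0.
Proof.
move=> r0 pq0 pqw E.
have pqE : `|p + q| ^+ 2 = `|p| ^+ 2 + `|q| ^+ 2 + 2 * <|p, q|>.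
  rewrite -!ipE !ip_linear (ipC q p); ring.
have yw := ip_young (p + q) w; have d0 := sqr_ge0 `|p + q - w|; split; last by lra.
by apply/eqP; rewrite eq_sym -subr_eq0; apply/eqP/norm_sqr_le0; lra.
Qed.

(** Since [p - r = d - q], the square [|p - r|^2] is [<p - r, d - q>], whose four terms are zero. *)
Lemma orthogonal_decomposition (p q d r : X) : p + q = d + r ->
  <|p, q|> = 0 -> <|d, r|> = 0 -> <|d, p|> = 0 -> <|r, q|> = 0 -> p = r /\ q = d.
Proof.
move=> pq pq0 dr0 dp0 rq0; have pr : p = r.
  apply/eqP; rewrite -subr_eq0; apply/eqP/norm_sqr_le0; rewrite -ipE.
  have {2}-> : p - r = d - q by apply/eqP; rewrite subr_eq addrAC -pq addrK.
  rewrite !ip_linear (ipC p d) dp0 pq0 rq0 (ipC r) dr0; lra.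
by split=> //; apply: (addrI p); rewrite pq pr addrC.
Qed.

(** * Domains and ranges of maximally monotone operators *)

(** Domains and ranges of maximally monotone operators may fail to be convex; their closures are
    convex. *)
Definition nearly_convex (S : set X) := forall a b t, S a -> S b ->
  0 <= t <= 1 -> closure S ((1 - t) *: a + t *: b).

Lemma closure_nearly_convex (S : set X) a b t : nearly_convex S ->
  closure S a -> closure S b -> 0 <= t <= 1 -> closure S ((1 - t) *: a + t *: b).
Proof.
move=> cS /closure_normP Sa /closure_normP Sb /andP[t0 t1].
apply/closure_normP => e e0; have e2 : 0 < e / 2 by lra.
have [a' Sa' aa'] := Sa _ e2; have [b' Sb' bb'] := Sb _ e2.
have t01 : 0 <= t <= 1 by rewrite t0.
have /closure_normP/(_ _ e2)[c Sc abc] := cS _ _ _ Sa' Sb' t01; exists c => //.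
rewrite (_ : _ - c = ((1 - t) *: (a - a') + t *: (b - b')) +
    ((1 - t) *: a' + t *: b' - c)); last first.
  by vector_ring.
apply: le_lt_trans (ler_normD _ _) _; rewrite [ltRHS](splitr e).
rewrite ler_ltD//; apply: le_trans (ler_normD _ _) _.
rewrite !normrZ !ger0_norm// ?subr_ge0//; nra.
Qed.

Lemma closure_set_sum (S1 S2 : set X) x y : closure S1 x -> closure S2 y ->
  closure (hset_sum S1 S2) (x + y).
Proof.
move=> /closure_normP S1x /closure_normP S2y; apply/closure_normP => e e0.
have e2 : 0 < e / 2 by lra.
have [a Sa xa] := S1x _ e2; have [b Sb yb] := S2y _ e2.
exists (a + b); first by exists a, b.
by rewrite opprD addrACA; apply: le_lt_trans (ler_normD _ _) _; lra.
Qed.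

Lemma closure_set_diff (S1 S2 : set X) x y : closure S1 x -> closure S2 y ->
  closure (hset_diff S1 S2) (x - y).
Proof.
move=> /closure_normP S1x /closure_normP S2y; apply/closure_normP => e e0.
have e2 : 0 < e / 2 by lra.
have [a Sa xa] := S1x _ e2; have [b Sb yb] := S2y _ e2.
exists (a - b); first by exists a, b.
rewrite opprD addrACA -opprD; apply: le_lt_trans (ler_normB _ _) _; lra.
Qed.

Lemma nearly_convex_sum (S1 S2 : set X) :
  nearly_convex S1 -> nearly_convex S2 -> nearly_convex (hset_sum S1 S2).
Proof.
move=> c1 c2 _ _ t [a [b [Sa [Sb ->]]]] [a' [b' [Sa' [Sb' ->]]]] t01.
rewrite !scalerDr addrACA.
by apply: closure_set_sum; [exact: c1|exact: c2].
Qed.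

Lemma nearly_convex_diff (S1 S2 : set X) :
  nearly_convex S1 -> nearly_convex S2 -> nearly_convex (hset_diff S1 S2).
Proof.
move=> c1 c2 _ _ t [a [b [Sa [Sb ->]]]] [a' [b' [Sa' [Sb' ->]]]] t01.
rewrite !scalerBr addrACA -opprD.
by apply: closure_set_diff; [exact: c1|exact: c2].
Qed.

(* The approximants are the resolvents of [A / L] at the convex combination,
   as [L] goes to infinity. *)
Lemma hdom_nearly_convex A : saturated_monotone A -> nearly_convex (hdom A).
Proof.
move=> satA a b t [u Aau] [w Abw] /andP[t0 t1]; set c := _ + _.
apply/closure_normP => e e0; pose p := (1 - t) *: u + t *: w.
(* Averaging the monotonicity inequalities at [a] and [b] and using Young's inequality gives
   [(2 L - 1) |c - x|^2 <= K], with [K] independent of [L]. *)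
pose K := 2 * ((1 - t) * <|a - c, u|> + t * <|b - c, w|>) + `|p| ^+ 2.
have e2 : 0 < e ^+ 2 by rewrite exprn_gt0.
have [k k0 kE] : exists2 k, 0 <= k & k * e ^+ 2 = `|K|.
  by exists (`|K| / e ^+ 2); rewrite ?divr_ge0 ?divfK// ?gt_eqF// ltW.
pose L := k + 1; have L0 : 0 < L by rewrite ltr_wpDl.
have [x Ax] := minty A L c satA L0; exists x; first by exists (L *: (c - x)).
have LK : (L *+ 2 - 1) * `|c - x| ^+ 2 <= K.
  have /(ler_wpM2l t0) := satA.1 _ _ _ _ Ax Abw.
  have /(ler_wpM2l (_ : 0 <= 1 - t)) := satA.1 _ _ _ _ Ax Aau.
  rewrite subr_ge0 => /(_ t1); rewrite !mulr0.
  have := ip_young (c - x) p; rewrite /K.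
  move: (`|p| ^+ 2) => q.
  rewrite -(ipE (c - x)) /c /p !ip_linear.
  rewrite (ipC x a) (ipC x b) (ipC b a) !mulrDr.
  lra.
rewrite norm_lt_eps// ltNge; apply/negP => exc.
have : (L *+ 2 - 1) * e ^+ 2 <= K.
  by apply: le_trans LK; rewrite ler_wpM2l// /L; lra.
have := ler_norm K; rewrite /L; nra.
Qed.

(** Minty's theorem solves the regularized inclusion [w + u - d x] in [A x]. Monotonicity against
    [(c, w)] and the half-space bound keep [d |x|^2 <= K], so the error [d x] vanishes with [d]. *)
Lemma hran_recession A (s : R) (u c w : X) : saturated_monotone A ->
  (forall a, hdom A a -> <|u, a|> <= s) -> A c w -> closure (hran A) (w + u).
Proof.
move=> satA us Acw; apply/closure_normP => e e0.
have e2 : 0 < e ^+ 2 by rewrite exprn_gt0.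
pose K := `|s - <|c, u|>| *+ 2 + `|c| ^+ 2.
have K0 : 0 <= K by rewrite addr_ge0// ?sqr_ge0// mulrn_wge0.
pose d := e ^+ 2 / (e ^+ 2 + K + 1).
have d0 : 0 < d by rewrite divr_gt0//; lra.
have d1 : d < 1 by rewrite ltr_pdivrMr; lra.
have dK : d * K < e ^+ 2.
  by rewrite mulrAC ltr_pdivrMr ?ltr_pM2l//; lra.
have [x] := minty A d (d^-1 *: (w + u)) satA d0.
rewrite scalerBr scalerA mulfV ?gt_eqF// scale1r => Ax.
exists (w + u - d *: x); first by exists x.
rewrite opprB addrC subrK norm_lt_eps//; apply: le_lt_trans dK.
rewrite normrZ (gtr0_norm d0) exprMn expr2 -mulrA ler_pM2l//.
have := satA.1 _ _ _ _ Ax Acw; have := us x (ex_intro _ _ Ax).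
have := ip_young x c; have := ler_norm (s - <|c, u|>); have := sqr_ge0 `|c|.
rewrite /K; move: (`|s - _|) => r; rewrite -!ipE !ip_linear.
rewrite (ipC u x) (ipC x c) => h1 h2 h3 h4 h5.
have : d * (2 * <|c, x|>) <= d * (<|x, x|> + <|c, c|>) by rewrite ler_pM2l.
nra.
Qed.

(** * Resolvents and projections of the origin *)

Lemma hresolvent_graph (C : X -> set X) y : saturated_monotone C ->
  C (hresolvent C y) (y - hresolvent C y).
Proof.
move=> satC; apply: (@xgetPex _ 0 [set p | C p (y - p)]).
by have [x] := minty C 1 y satC ltr01; rewrite scale1r; exists x.
Qed.

Lemma hresolvent_eq (C : X -> set X) y p : hmonotone ip C -> C p (y - p) ->
  hresolvent C y = p.
Proof.
move=> mC Cp; apply: xget_unique => // q Cq.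
apply/eqP; rewrite -subr_eq0; apply/eqP/norm_sqr_le0.
have := mC _ _ _ _ Cq Cp; rewrite -!ipE !ip_linear; lra.
Qed.

Lemma hresolvent_inv (C : X -> set X) y : saturated_monotone C ->
  hresolvent (hop_inv C) y = y - hresolvent C y.
Proof.
move=> satC; apply: hresolvent_eq; first exact: (saturated_inv _ satC).1.
by rewrite /hop_inv opprB addrC subrK; exact: hresolvent_graph.
Qed.

Lemma hproj0_spec (S : set X) : S !=set0 -> nearly_convex S ->
  closure S (hproj (closure S) 0) /\
  forall q, closure S q -> `|hproj (closure S) 0| ^+ 2 <= <|hproj (closure S) 0, q|>.
Proof.
move=> [s Ss] cS; have [||a b t Sa Sb t01|Sp p_min] := hproj_spec (closure S) 0.
- by exists s; exact: subset_closure.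
- exact: closed_closure.
- exact: closure_nearly_convex.
- by split=> // q /p_min; rewrite subr0 ipE.
Qed.

(** * The vectors [vD], [vR] and their sum *)

Section MinimalDisplacement.
Variables (A B : X -> set X).
Hypotheses (satA : saturated_monotone A) (satB : saturated_monotone B).

Let D := hset_diff (hdom A) (hdom B).
Let Rr := hset_sum (hran A) (hran B).
Let vD := hproj (closure D) 0.
Let vR := hproj (closure Rr) 0.

Lemma vD_spec : closure D vD /\ forall q, closure D q -> `|vD| ^+ 2 <= <|vD, q|>.
Proof.
apply: hproj0_spec; last by apply: nearly_convex_diff; exact: hdom_nearly_convex.
have [a [u Au]] := saturated_nonempty _ satA.
have [b [w Bw]] := saturated_nonempty _ satB.
by exists (a - b), a, b; split; [exists u|split=> //; exists w].
Qed.

Lemma vR_spec : closure Rr vR /\ forall q, closure Rr q -> `|vR| ^+ 2 <= <|vR, q|>.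
Proof.
apply: hproj0_spec; last first.
  by apply: nearly_convex_sum; apply: (hdom_nearly_convex (hop_inv _));
    exact: saturated_inv.
have [a [u Au]] := saturated_nonempty _ satA.
have [b [w Bw]] := saturated_nonempty _ satB.
by exists (u + w), u, w; split; [exists a|split=> //; exists b].
Qed.

(* The half-space bounds given by [vD] on [dom A] and [dom B] turn [- vD] and [vD]
   into recession directions of the closures of [ran A] and [ran B]. *)
Lemma hran_sub_vD c w : A c w -> closure (hran A) (w - vD).
Proof.
have [_ vDm] := vD_spec; have [b [z Bz]] := saturated_nonempty _ satB.
apply: (hran_recession A (- `|vD| ^+ 2 - <|vD, b|>)) => // a Aa.
have : D (a - b) by exists a, b; split=> //; split=> //; exists z.
move=> /subset_closure/vDm; rewrite !ip_linear; lra.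
Qed.

Lemma hran_add_vD c w : B c w -> closure (hran B) (w + vD).
Proof.
have [_ vDm] := vD_spec; have [a [z Az]] := saturated_nonempty _ satA.
apply: (hran_recession B (<|vD, a|> - `|vD| ^+ 2)) => // b Bb.
have : D (a - b) by exists a, b; split; [exists z|].
move=> /subset_closure/vDm; rewrite !ip_linear; lra.
Qed.

Lemma hdom_sub_vR c w : B c w -> closure (hdom B) (c - vR).
Proof.
have [_ vRm] := vR_spec; have [a [z Az]] := saturated_nonempty _ satA.
apply: (hran_recession (hop_inv B) (<|vR, z|> - `|vR| ^+ 2)); first exact: saturated_inv.
move=> u Bu; have : Rr (z + u) by exists z, u; split; [exists a|].
move=> /subset_closure/vRm; rewrite !ip_linear; lra.
Qed.

(** Moving [dom B] by [- vR] moves [D] by [vR], so [vR] is a recession direction of [closure D],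
    which contains [vD]. *)
Lemma add_vR_vD_closure_D : closure D (vR + vD).
Proof.
rewrite addrC; apply: closure_add; last exact: vD_spec.1.
move=> _ [a [b [Aa [[w Bw] ->]]]]; rewrite -addrA [- b + vR]addrC -opprB.
apply: closure_set_diff (subset_closure Aa) _.
exact: hdom_sub_vR Bw.
Qed.

Lemma add_vR_vD_closure_R : closure Rr (vR + vD).
Proof.
apply: closure_add; last exact: vR_spec.1.
move=> _ [u [w [Au [[b Bw] ->]]]]; rewrite -addrA.
apply: closure_set_sum (subset_closure Au) _; exact: hran_add_vD Bw.
Qed.

Lemma sub_vR_vD_closure_R : closure Rr (vR - vD).
Proof.
apply: closure_add; last exact: vR_spec.1.
move=> _ [u [w [[a Au] [Bw ->]]]]; rewrite addrAC.
apply: closure_set_sum _ (subset_closure Bw); exact: hran_sub_vD Au.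
Qed.

(** Minimality of [vR] tested at [vR + vD] and at [vR - vD] bounds the product from both sides. *)
Lemma vD_vR_orthogonal : <|vD, vR|> = 0.
Proof.
have := vR_spec.2 _ add_vR_vD_closure_R; have := vR_spec.2 _ sub_vR_vD_closure_R.
by rewrite -ipE !ip_linear (ipC vR vD); lra.
Qed.

Lemma hproj0_closureI : hproj (closure D `&` closure Rr) 0 = vD + vR.
Proof.
set v := hproj _ 0.
have DR : (closure D `&` closure Rr) (vD + vR).
  by rewrite addrC; split; [exact: add_vR_vD_closure_D|exact: add_vR_vD_closure_R].
(* Adding the variational inequalities of [vD] and [vR]; the cross terms vanish by orthogonality. *)
have vmin q : closure D q -> closure Rr q -> `|vD + vR| ^+ 2 <= <|vD + vR, q|>.
  move=> /vD_spec.2 + /vR_spec.2; rewrite -!ipE !ip_linear (ipC vR vD) vD_vR_orthogonal; lra.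
have [] : (closure D `&` closure Rr) v /\
    forall q, (closure D `&` closure Rr) q -> `|0 - v| <= `|0 - q|.
  rewrite /v /hproj; apply: (@xgetPex _ 0 [set p | _ p /\ _]); exists (vD + vR); split=> // q [Dq Rq].
  rewrite !sub0r !normrN norm_le_sqr; have := ip_young (vD + vR) q; have := vmin q Dq Rq; lra.
move=> [Dv Rv] /(_ _ DR); rewrite !sub0r !normrN norm_le_sqr => h.
apply/eqP; rewrite -subr_eq0; apply/eqP/norm_sqr_le0.
have := vmin v Dv Rv; move: h; rewrite -!ipE !ip_linear.
rewrite (ipC v vD) (ipC v vR); lra.
Qed.

(** * Shadows of the Douglas-Rachford iteration *)

Let T (y : X) := y - hresolvent A y + hresolvent B (hreflected A y).
(** [(P y, Q y)] lies in the graph of [A] and [(b y, c y)] in that of [B]; [Q] and [c] are the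
    resolvents of the inverses, at [y] and at the reflected point. *)
Let P (y : X) := hresolvent A y.
Let Q (y : X) := y - hresolvent A y.
Let b (y : X) := hresolvent B (hreflected A y).
Let c (y : X) := hreflected A y - b y.
Let v := vD + vR.

Lemma T_sub_D y : y - T y = P y - b y.
Proof. by rewrite /T /P /b; vector_ring. Qed.

Lemma T_sub_R y : y - T y = Q y + c y.
Proof. by rewrite T_sub_D /P /Q /c /hreflected; vector_ring. Qed.

Lemma shadows_norm_le y z :
  `|P (T y) - P (T z)| ^+ 2 + `|Q (T y) - Q (T z)| ^+ 2 <= `|T y - T z| ^+ 2.
Proof.
have := satA.1 _ _ _ _ (hresolvent_graph A (T y) satA) (hresolvent_graph A (T z) satA).
rewrite -/(P (T y)) -/(P (T z)) -/(Q (T y)) -/(Q (T z)).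
have -> : T y - T z = (P (T y) - P (T z)) + (Q (T y) - Q (T z)).
  by rewrite /P /Q; vector_ring.
move: (P _ - P _) (Q _ - Q _) => p q; rewrite -!ipE !ip_linear (ipC q p); lra.
Qed.

(** The slack [r] is exactly twice the monotonicity product of [B] at the two points [(b, c)]. *)
Lemma shadows_norm_eq y z : exists2 r, 0 <= r &
  `|P y - P z| ^+ 2 + `|Q y - Q z| ^+ 2 =
  `|T y - T z| ^+ 2 + `|(y - T y) - (z - T z)| ^+ 2 + r.
Proof.
exists (2 * <|b y - b z, c y - c z|>).
  by rewrite mulr_ge0//; apply: satB.1; exact: hresolvent_graph.
have cE u : c u = P u - Q u - b u.
  by rewrite /P /Q /c /hreflected; vector_ring.
have TE u : T u = Q u + b u by [].
rewrite !T_sub_D !cE !TE.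
have -> : Q y + b y - (Q z + b z) = (Q y - Q z) + (b y - b z).
  by vector_ring.
have -> : P y - b y - (P z - b z) = (P y - P z) - (b y - b z).
  by vector_ring.
have -> : P y - Q y - b y - (P z - Q z - b z) = (P y - P z) - (Q y - Q z) - (b y - b z).
  by vector_ring.
move: (P y - P z) (Q y - Q z) (b y - b z) => p q r.
by rewrite -!ipE !ip_linear (ipC q r) (ipC p r); ring.
Qed.

Lemma shadows_nonexpansive y z :
  `|P (T y) - P (T z)| ^+ 2 + `|Q (T y) - Q (T z)| ^+ 2 <=
  `|P y - P z| ^+ 2 + `|Q y - Q z| ^+ 2.
Proof.
apply: le_trans (shadows_norm_le y z) _; have [r r0 ->] := shadows_norm_eq y z.
have := sqr_ge0 `|(y - T y) - (z - T z)|; lra.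
Qed.

(** Two independent points are allowed, which makes the cross comparisons in [fix_step] possible. *)
Lemma vD_le y z : `|vD| ^+ 2 <= <|vD, P y - b z|>.
Proof.
apply: vD_spec.2; apply: subset_closure; exists (P y), (b z).
by split; [|split=> //]; eexists; exact: hresolvent_graph.
Qed.

Lemma vR_le y z : `|vR| ^+ 2 <= <|vR, Q y + c z|>.
Proof.
apply: vR_spec.2; apply: subset_closure; exists (Q y), (c z).
by split; [|split=> //]; eexists; exact: hresolvent_graph.
Qed.

Lemma fix_step y : y = v + T y ->
  [/\ T y = v + T (T y), P (T y) = P y - vR & Q (T y) = Q y - vD].
Proof.
move=> yfix; have wy : y - T y = v by rewrite {1}yfix addrK.
set z := T y; set w := z - T z.
pose p := P y - P z; pose q := Q y - Q z.
have pq : p + q = v.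
  by rewrite -wy /p /q /P /Q; vector_ring.
(* As a displacement, [w] lies in both [D] and [Rr], so both variational inequalities apply to
   it. *)
have vw : `|p + q| ^+ 2 <= <|p + q, w|>.
  have wE : <|p + q, w|> = <|vD, w|> + <|vR, w|> by rewrite pq /v ipDl.
  have vE : `|p + q| ^+ 2 = `|vD| ^+ 2 + `|vR| ^+ 2.
    rewrite pq /v -!ipE !ip_linear (ipC vR vD) vD_vR_orthogonal; ring.
  have := vD_le z z; have := vR_le z z; rewrite -T_sub_D -T_sub_R -/w wE vE; lra.
have pq0 : 0 <= <|p, q|> by apply: satA.1; exact: hresolvent_graph.
have [r r0 pqE] := shadows_norm_eq y z.
rewrite wy -/z -/w -/p -/q -pq in pqE.
have [wpq {}pq0] := displacement_rigid p q w r r0 pq0 vw pqE.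
have wz : z - T z = v by rewrite -/w wpq.
have bz u : u - T u = v -> b u = P u - v.
  by move=> <-; rewrite T_sub_D opprB addrC subrK.
have cz u : u - T u = v -> c u = v - Q u.
  by move=> <-; rewrite T_sub_R addrC addKr.
(* Here [P y - b z = v + p] and [P z - b y = v - p], so [vD_le] gives both signs. *)
have vDp : <|vD, p|> = 0.
  have := vD_le y z; have := vD_le z y; rewrite !bz// -ipE /p /v !ip_linear.
  rewrite vD_vR_orthogonal; lra.
have vRq : <|vR, q|> = 0.
  have := vR_le y z; have := vR_le z y; rewrite !cz// -ipE /q /v !ip_linear.
  rewrite (ipC vR vD) vD_vR_orthogonal; lra.
have [pR qD] := orthogonal_decomposition p q vD vR pq pq0 vD_vR_orthogonal vDp vRq.
split; first by rewrite -wz subrK.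
  by rewrite -pR /p opprB addrC subrK.
by rewrite -qD /q opprB addrC subrK.
Qed.

Lemma iter_fix y n : y = v + T y ->
  [/\ iter n T y = v + T (iter n T y), P (iter n T y) = P y - n%:R *: vR &
      Q (iter n T y) = Q y - n%:R *: vD].
Proof.
move=> yfix; elim: n => [|n [IHf IHP IHQ]]; first by rewrite !scale0r !subr0.
have [fT PT QT] := fix_step _ IHf; split; rewrite iterS //.
- by rewrite PT IHP -natr1; vector_ring.
- by rewrite QT IHQ -natr1; vector_ring.
Qed.

Lemma shadows_fejer x y n : y = v + T y ->
  `|P (iter n.+1 T x) + n.+1%:R *: vR - P y| ^+ 2 +
  `|Q (iter n.+1 T x) + n.+1%:R *: vD - Q y| ^+ 2 <=
  `|P (iter n T x) + n%:R *: vR - P y| ^+ 2 +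
  `|Q (iter n T x) + n%:R *: vD - Q y| ^+ 2.
Proof.
move=> yfix; have shift m : forall a d e : X, a + m%:R *: d - e = a - (e - m%:R *: d).
  by move=> a d e; vector_ring.
have [_ P1 Q1] := iter_fix y n.+1 yfix; have [_ P0 Q0] := iter_fix y n yfix.
rewrite !shift -P1 -Q1 -P0 -Q0 !iterS; exact: shadows_nonexpansive.
Qed.

(** The point [y = z + (k + v)] has shadows [z] and [k + v], and its reflection is
    [(z - v) + (- k)], which [B] resolves to [z - v]. *)
Lemma fix_of_solution z k : B (z - v) (- k) -> A z (k + v) ->
  exists y, [/\ y = v + T y, P y = z & Q y = k + v].
Proof.
move=> Bzk Azk; pose y := z + (k + v).
have Py : P y = z by apply: hresolvent_eq; [exact: satA.1|rewrite (_ : y - z = k + v) // /y addrC addKr].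
have Qy : Q y = k + v by rewrite /Q -/(P y) Py /y addrC addKr.
have by_ : b y = z - v.
  apply: hresolvent_eq; first exact: satB.1.
  rewrite (_ : hreflected A y - _ = - k)// /hreflected -/(P y) Py /y.
  by vector_ring.
exists y; split=> //.
by rewrite /T -/(P y) -/(Q y) -/(b y) Qy by_ /y; vector_ring.
Qed.

End MinimalDisplacement.
End Hilbert.

(** * Bounded and drifting sequences *)

Lemma hpnorm_le {R : realType} {X : completeNormedModType R} (p q : X * X) :
  `|p.1| ^+ 2 + `|p.2| ^+ 2 <= `|q.1| ^+ 2 + `|q.2| ^+ 2 -> hpnorm p <= hpnorm q.
Proof. exact: ler_wsqrtr. Qed.

Lemma hbounded_add {R : realType} {X : completeNormedModType R} (a b : nat -> X) :
  hbounded_seq a -> hbounded_seq b -> hbounded_seq (fun n => a n + b n).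
Proof.
move=> [M aM] [N bN]; exists (M + N) => n.
by apply: le_trans (ler_normD _ _) _; exact: lerD.
Qed.

Lemma hbounded_opp {R : realType} {X : completeNormedModType R} (a : nat -> X) :
  hbounded_seq a -> hbounded_seq (fun n => - a n).
Proof. by move=> [M aM]; exists M => n; rewrite normrN. Qed.

Lemma hbounded_cst {R : realType} {X : completeNormedModType R} (a : X) :
  hbounded_seq (fun _ => a).
Proof. by exists `|a|. Qed.

Lemma hpbounded_pair {R : realType} {X : completeNormedModType R} (s : nat -> X * X) :
  hpbounded s <-> hbounded_seq (fun n => (s n).1) /\ hbounded_seq (fun n => (s n).2).
Proof.
split=> [[M sM]|[[M sM] [N sN]]].
  by split; exists M => n; apply: le_trans (sM n);
    rewrite -[leLHS]ger0_norm// -sqrtr_sqr ler_wsqrtr// (lerDl, lerDr) sqr_ge0.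
exists (M + N) => n; apply: le_trans (lerD (sM n) (sN n)).
have h : 0 <= `|(s n).1| + `|(s n).2| by rewrite addr_ge0.
rewrite -[leRHS](ger0_norm h) -sqrtr_sqr ler_wsqrtr// sqrrD.
by rewrite addrAC lerDl mulrn_wge0// mulr_ge0.
Qed.

Lemma hfejer_bounded {R : realType} {X : completeNormedModType R} (s : nat -> X * X)
  (C : set (X * X)) : hfejer s C -> C !=set0 -> hpbounded s.
Proof.
move=> sC [c Cc].
have /hpbounded_pair[b1 b2] : hpbounded (fun n => s n - c).
  exists (hpnorm (s 0%N - c)) => n.
  by elim: n => // n; apply: le_trans; exact: sC.
apply/hpbounded_pair; split.
  have := hbounded_add _ _ b1 (hbounded_cst c.1).
  by under eq_fun do rewrite subrK.
have := hbounded_add _ _ b2 (hbounded_cst c.2).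
by under eq_fun do rewrite subrK.
Qed.

(** If [M] bounds the corrected sequence, then [|a n| >= n |d| - M]. *)
Lemma hbounded_drift {R : realType} {X : completeNormedModType R} (a : nat -> X) (d : X) :
  hbounded_seq (fun n => a n + n%:R *: d) ->
  (hbounded_seq a <-> d = 0) /\ (d <> 0 -> (fun n => `|a n|) @ \oo --> +oo).
Proof.
move=> bad; have cvg : d <> 0 -> (fun n => `|a n|) @ \oo --> +oo.
  move=> /eqP d0; have [M adM] := bad.
  have nd : 0 < `|d| by rewrite normr_gt0.
  apply/cvgryPge => K; near=> n.
  have : (K + M) / `|d| <= n%:R by near: n; exact: nbhs_infty_ger.
  rewrite ler_pdivrMr// => Kn; have := adM n.
  have := ler_normB (a n + n%:R *: d) (a n).
  by rewrite addrAC subrr add0r normrZ normr_nat; lra.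
split=> //; split=> [[N aN]|d0]; last by move: bad; rewrite d0; under eq_fun do rewrite scaler0 addr0.
apply: contrapT => /cvg/cvgryPgt/(_ N) [n _ /(_ n (leqnn n))].
by rewrite /= ltNge aN.
Unshelve. all: by end_near. Qed.

(** * The nine assertions on the shadow sequences *)

Theorem theorem5p5 (R : realType) (X : completeNormedModType R)
  (ip : X -> X -> R) (A B : X -> set X) (f x : X) :
  hinner_product ip ->
  hmaximally_monotone ip A -> hmaximally_monotone ip B ->
  let T := fun y => y - hresolvent A y + hresolvent B (hreflected A y) in
  let v : X := hproj (closure (range (fun y => y - T y))) 0 in
  let D := hset_diff (hdom A) (hdom B) in
  let Rr := hset_sum (hran A) (hran B) in
  let vD : X := hproj (closure D) 0 in
  let vR : X := hproj (closure Rr) 0 in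
  closure (range (fun y => y - T y)) = closure (D `&` Rr) ->
  closure (D `&` Rr) = closure D `&` closure Rr ->
  hfixset (fun y : X => v + T y) f ->
  let Tn := fun n : nat => iter n T x in
  let s := fun n : nat =>
    (hresolvent A (Tn n) + n%:R *: vR, hresolvent (hop_inv A) (Tn n) + n%:R *: vD) in
  let S : set (X * X) := (fun p : X * X => B (p.1 - v) (- p.2) /\ A p.1 (p.2 + v)) in
  let Z : set X := (fun z : X => exists a b, A z a /\ B (z - v) b /\ 0 = - v + a + b) in
  let K : set X := (fun k : X => exists z, A z (k + v) /\ exists w, B w (- k) /\ z = v + w) in
  (* (i) *)
  hfejer s (fun p : X * X => exists y : X, hfixset (fun y : X => v + T y) y /\
                    p = (hresolvent A y, hresolvent (hop_inv A) y)) /\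
  (* (ii) *)
  hpbounded s /\
  (* (iii) *)
  hpbounded (fun n => (hresolvent B (hreflected A (Tn n)) + n%:R *: vR,
                      hresolvent (hop_inv B) (hreflected A (Tn n)) - n%:R *: vD)) /\
  (* (iv) *)
  hfejer (fun n => ((0 : X), - v) + s n) S /\
  (* (v) *)
  (hbounded_seq (fun n => hresolvent A (Tn n)) <-> vR = 0) /\
  (* (vi) *)
  (vR <> 0 -> (fun n => `|hresolvent A (Tn n)|) @ \oo --> +oo) /\
  (* (vii) *)
  (hbounded_seq (fun n => hresolvent (hop_inv A) (Tn n)) <-> vD = 0) /\
  (* (viii) *)
  (vD <> 0 -> (fun n => `|hresolvent (hop_inv A) (Tn n)|) @ \oo --> +oo) /\
  (* (ix) *)
  (hparamonotone ip A -> hparamonotone ip B ->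
     hfejer (fun n => ((0 : X), - v) + s n) (fun p : X * X => Z p.1 /\ K p.2)).
Proof.
move=> ipX maxA maxB T v D Rr vD vR ranD DR ffix Tn s S Z K.
have satA := hmaximally_monotone_saturated R X ip ipX A maxA.
have satB := hmaximally_monotone_saturated R X ip ipX B maxB.
have vE : v = vD + vR by rewrite /v ranD DR; exact: (hproj0_closureI R X ip ipX A B satA satB).
pose P := hresolvent A; pose Q y := y - P y.
have QE y : hresolvent (hop_inv A) y = Q y by exact: (hresolvent_inv R X ip ipX A y satA).
have fixE y : hfixset (fun y => v + T y) y -> y = vD + vR + T y by rewrite -vE.
have i : hfejer s (fun p => exists y, hfixset (fun y => v + T y) y /\
    p = (hresolvent A y, hresolvent (hop_inv A) y)).
  move=> _ n [y [/fixE yfix ->]]; apply: hpnorm_le; rewrite /s /= !QE.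
  exact: (shadows_fejer R X ip ipX A B satA satB x y n yfix).
have ii : hpbounded s by apply: (hfejer_bounded _ _ i); exists (P f, hresolvent (hop_inv A) f), f.
have [bP bQ] := (hpbounded_pair s).1 ii.
(* The components of [s n] add up to [Tn n + n v]; consecutive differences of these bounded sums are
   the displacements up to the constant [v]. *)
have bw : hbounded_seq (fun n => Tn n - T (Tn n)).
  have bS (a : nat -> X) : hbounded_seq a -> hbounded_seq (fun n => a n.+1).
    by move=> [M aM]; exists M.
  have bPQ := hbounded_add _ _ bP bQ.
  have := hbounded_add _ _ (hbounded_add _ _ bPQ (hbounded_opp _ (bS _ bPQ))) (hbounded_cst v).
  congr (hbounded_seq _); apply/funext => n; rewrite /s /= !QE /Q vE -natr1.
  apply: (ip_ext R X ip ipX) => z.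
  rewrite !(ipDl _ _ _ ipX, ipNl _ _ _ ipX, ipZl _ _ _ ipX); ring.
(* Use [b = P - (Id - T)] and [c = (Id - T) - Q], with bounded displacements. *)
have iii : hpbounded (fun n => (hresolvent B (hreflected A (Tn n)) + n%:R *: vR,
    hresolvent (hop_inv B) (hreflected A (Tn n)) - n%:R *: vD)).
  apply/hpbounded_pair; split=> /=.
    have := hbounded_add _ _ bP (hbounded_opp _ bw).
    congr (hbounded_seq _); apply/funext => n; rewrite /s /= /T.
    apply: (ip_ext R X ip ipX) => z.
    rewrite !(ipDl _ _ _ ipX, ipNl _ _ _ ipX, ipZl _ _ _ ipX); ring.
  have := hbounded_add _ _ bw (hbounded_opp _ bQ).
  congr (hbounded_seq _); apply/funext => n.
  rewrite (hresolvent_inv R X ip ipX B _ satB) /s /= QE /Q /P /T /hreflected.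
  apply: (ip_ext R X ip ipX) => z.
  rewrite !(ipDl _ _ _ ipX, ipNl _ _ _ ipX, ipZl _ _ _ ipX); ring.
have iv : hfejer (fun n => (0, - v) + s n) S.
  move=> [z k] n [/= Bzk Azk]; rewrite vE in Bzk Azk.
  have [y [yfix Py Qy]] := fix_of_solution R X ip ipX A B satA satB z k Bzk Azk.
  have shift m : (0, - v) + s m - (z, k) = s m - (P y, hresolvent (hop_inv A) y).
    rewrite QE /P Py /Q /P Qy -vE; congr (_, _); rewrite /= ?add0r//.
    by rewrite [- v + _]addrC -addrA -opprD [v + k]addrC.
  by rewrite !shift; apply: i; exists y; split=> //; rewrite /hfixset /= vE.
have [v_ vi] := hbounded_drift _ _ bP.
have [vii viii] := hbounded_drift _ _ bQ.
refine (conj i (conj ii (conj iii (conj iv (conj v_ (conj vi (conj vii (conj viii _)))))))).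
move=> [mA pA] [mB pB] [z k] n []; rewrite /Z /K /=.
move=> [a [b [Aza [Bzb ab]]]] [z' [Azk [w [Bwk zw]]]].
apply: iv; rewrite /S /=.
have Bzk' : B (z' - v) (- k) by rewrite zw addrC addKr.
have bE : b = v - a.
  by apply/eqP; rewrite -subr_eq0 opprB addrC [a - v]addrC -ab.
have hA := mA _ _ _ _ Aza Azk; have hB := mB _ _ _ _ Bzb Bzk'.
(* Because [a + b = v = (k + v) + (- k)], the two nonnegative products cancel, so both vanish.
   Paramonotonicity then gives [A z (k + v)] and [B (z - v) (- k)], that is, [(z, k)] in [S]. *)
have hAB : ip (z - z') (a - (k + v)) + ip (z - v - (z' - v)) (b - - k) = 0.
  rewrite bE !(ipDl _ _ _ ipX, ipNl _ _ _ ipX, ipDr _ _ _ ipX, ipNr _ _ _ ipX); ring.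
have [Azk'' _] := pA _ _ _ _ Aza Azk ltac:(lra).
by have [Bzk'' _] := pB _ _ _ _ Bzb Bzk' ltac:(lra).
Qed.
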